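(* Let $0<c_e<\infty$ for all $e\in\mathcal E_{\mathrm c}$ and $0<w_{\min}\le w_{\max}$, and order the candidate costs as $c_{(1)}\le\cdots\le c_{(p)}$. Then $(\mathcal P0)$ is feasible for $(C,k)$ if and only if $$k\le p\quad\text{and}\quad C\ge w_{\min}\sum_{i=1}^kc_{(i)} .$$ Under this condition, the reserve-capped greedy algorithm has at least one admissible candidate at every iteration $l=1,\dots,k$, and it returns a feasible exact-$k$ solution of $(\mathcal P0)$ (that is, setting $z_e=1$ and $w_e$ equal to the committed weight for the selected edges, and $z_e=w_e=0$ for all other candidates, gives a feasible point of $(\mathcal P0)$ with exactly $k$ selected edges).
   Context: Let $\mathcal G$ be an undirected connected graph on $n$ nodes $v_1,\dots,v_n$ with base edge set $\mathcal E_{\mathrm b}$ (no self-loops) and fixed positive base edge weights; let $\mathbf L_{\mathrm b}$ be its weighted Laplacian. Let $\mathcal E_{\mathrm c}$ be a set of $p$ candidate edges (unordered pairs of distinct nodes, disjoint from $\mathcal E_{\mathrm b}$), with per-unit costs $c_e$. For a candidate $e=\{v_i,v_j\}$, $\mathbf a_e\in\mathbb R^n$ has $i$-th entry $1$, $j$-th entry $-1$ (arbitrary orientation) and zeros elsewhere. For $\mathbf w\in\mathbb R^p_{\ge0}$, $\mathbf M(\mathbf w)=\mathbf L_{\mathrm b}+\sum_ew_e\mathbf a_e\mathbf a_e^\top+\frac1n\mathbf 1\mathbf 1^\top\succ0$ and $R_{\mathrm{tot}}(\mathbf w)=n\operatorname{Tr}(\mathbf M(\mathbf w)^{-1})-n$.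 The budget is $C>0$ and the target cardinality is an integer $k\ge1$. Problem $(\mathcal P0)$ for $(C,k)$: minimize $R_{\mathrm{tot}}(\mathbf w)$ over $\mathbf w\in\mathbb R^p_{\ge0}$, $\mathbf z\in\{0,1\}^p$ subject to $\mathbf c^\top\mathbf w\le C$; $z_ew_{\min}\le w_e\le z_ew_{\max}$ for all $e$; $\mathbf 1^\top\mathbf z=k$. Reserve-capped greedy algorithm. Initialize $\mathbf M'_0=\mathbf L_{\mathrm b}+\frac1n\mathbf 1\mathbf 1^\top$, $\mathcal E_{\mathrm{used}}^{(0)}=\emptyset$, $\mathcal E_{\mathrm{rem}}^{(0)}=\mathcal E_{\mathrm c}$, $C_{\mathrm{rem}}^{(0)}=C$. If $p<k$ or $C<w_{\min}\sum_{i=1}^kc_{(i)}$, stop and report no design. Otherwise, for $l=1,\dots,k$: 1. Let $r=k-|\mathcal E_{\mathrm{used}}^{(l-1)}|$ and $s=C_{\mathrm{rem}}^{(l-1)}/r$. 2. For each $e\in\mathcal E_{\mathrm{rem}}^{(l-1)}$ let the reserve $R_e$ be $w_{\min}$ times the sum of the $r-1$ smallest costs among the edges of $\mathcal E_{\mathrm{rem}}^{(l-1)}\setminus\{e\}$ (with $R_e=0$ if $r=1$). The candidate $e$ is admissible if $c_ew_{\min}\le C_{\mathrm{rem}}^{(l-1)}-R_e$. For an admissible $e$ the trial weight is $$w_e=\min\Bigl\{\max\bigl\{w_{\min},\min\{w_{\max},s/c_e\}\bigr\},\ \frac{C_{\mathrm{rem}}^{(l-1)}-R_e}{c_e}\Bigr\}$$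 and the gain is $\Delta R_{\mathrm{tot}}(e)=\dfrac{n\,w_e\,b_e^2}{1+w_er_e}$, where $r_e=\mathbf a_e^\top(\mathbf M'_{l-1})^{-1}\mathbf a_e$ and $b_e^2=\|(\mathbf M'_{l-1})^{-1}\mathbf a_e\|_2^2$. 3. Select the admissible $e^\star$ of largest gain (ties broken by enumeration order), commit its trial weight $w_{e^\star}$, and set $C_{\mathrm{rem}}^{(l)}=C_{\mathrm{rem}}^{(l-1)}-c_{e^\star}w_{e^\star}$, $\mathcal E_{\mathrm{rem}}^{(l)}=\mathcal E_{\mathrm{rem}}^{(l-1)}\setminus\{e^\star\}$, $\mathcal E_{\mathrm{used}}^{(l)}=\mathcal E_{\mathrm{used}}^{(l-1)}\cup\{e^\star\}$, $\mathbf M'_l=\mathbf M'_{l-1}+w_{e^\star}\mathbf a_{e^\star}\mathbf a_{e^\star}^\top$. The output is the set of selected edges with their committed weights. *)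

(* Defs.v *)
(* MathComp; the scalars range over an arbitrary realFieldType (in particular
   the real numbers), since no limit or root is involved. *)
From mathcomp Require Import all_boot all_order all_algebra.

Set Implicit Arguments.
Unset Strict Implicit.
Unset Printing Implicit Defensive.

Import Order.TTheory GRing.Theory Num.Theory.
Local Open Scope ring_scope.

(* The nodes are the elements of 'I_n, undirected edges are two-element sets
   of nodes.  Candidate edges are indexed by 'I_p, which also fixes their
   enumeration order; the pair (cand_tail e, cand_head e) is an arbitrary
   orientation of the candidate edge [set cand_tail e; cand_head e]. *)
Record network (R : realFieldType) (n p : nat) := Network {
  base_edges : {set {set 'I_n}};
  base_weight : {set 'I_n} -> R;
  cand_tail : 'I_p -> 'I_n;
  cand_head : 'I_p -> 'I_n;
  node_gt0 : (0 < n)%N;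
  base_edges_card : forall b, b \in base_edges -> #|b| = 2%N;
  base_weight_gt0 : forall b, b \in base_edges -> 0 < base_weight b;
  base_connected : forall i j : 'I_n,
    connect (fun x y => [set x; y] \in base_edges) i j;
  cand_no_loop : forall e, cand_tail e != cand_head e;
  cand_inj : injective (fun e => [set cand_tail e; cand_head e]);
  cand_notin_base : forall e, [set cand_tail e; cand_head e] \notin base_edges
}.

Record min_problem (R : realFieldType) (X : Type) := MinProblem {
  feasible_point : X -> Prop;
  objective : X -> R
}.

Definition feasible (R : realFieldType) (X : Type) (P : min_problem R X) :=
  exists x, feasible_point P x.

Section Resistance.
Variables (R : realFieldType) (n p : nat) (G : network R n p).

Definition base_laplacian : 'M[R]_n :=
  \matrix_(i, j)
    if i == j then \sum_(b in base_edges G | i \in b) base_weight G b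
    else if [set i; j] \in base_edges G then - base_weight G [set i; j]
    else 0.

Definition incidence (e : 'I_p) : 'cV[R]_n :=
  \col_i ((i == cand_tail G e)%:R - (i == cand_head G e)%:R).

Definition base_matrix : 'M[R]_n := base_laplacian + const_mx (n%:R^-1).

Definition resistance_matrix (w : 'cV[R]_p) : 'M[R]_n :=
  base_laplacian + \sum_e w e 0 *: (incidence e *m (incidence e)^T)
    + const_mx (n%:R^-1).

Definition total_resistance (w : 'cV[R]_p) : R :=
  n%:R * \tr (invmx (resistance_matrix w)) - n%:R.

End Resistance.

Section Design.
Variables (R : realFieldType) (n p : nat) (G : network R n p).
Variables (c : 'cV[R]_p) (wmin wmax C : R) (k : nat).

(* Sum of the m smallest costs among the candidates in A; only meaningful for
   m <= #|A| (missing entries count as 0). *)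
Definition smallest_costs_sum (A : {set 'I_p}) (m : nat) : R :=
  \sum_(0 <= i < m) (sort <=%R [seq c e 0 | e in A])`_i.

(* The binary vector z is a Boolean column, whose entries coerce to 0 or 1. *)
Definition P0_constraints (w : 'cV[R]_p) (z : 'cV[bool]_p) : Prop :=
  [/\ forall e, 0 <= w e 0,
      (c^T *m w) 0 0 <= C,
      forall e, (z e 0)%:R * wmin <= w e 0 <= (z e 0)%:R * wmax
    & (\sum_e (z e 0%R : nat))%N = k].

Definition P0 : min_problem R ('cV[R]_p * 'cV[bool]_p) :=
  MinProblem (fun wz => P0_constraints wz.1 wz.2)
             (fun wz => total_resistance G wz.1).

(* committed f 0 is relevant only for f in used. *)
Record state := State {
  grounded_matrix : 'M[R]_n;
  used : {set 'I_p};
  remaining : {set 'I_p};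
  budget_rem : R;
  committed : 'cV[R]_p
}.

Definition init_state : state :=
  State (base_matrix G) set0 setT C 0.

Section Iteration.
Variable st : state.

Definition picks_left : nat := (k - #|used st|)%N.

Definition budget_share : R := budget_rem st / picks_left%:R.

Definition reserve (e : 'I_p) : R :=
  wmin * smallest_costs_sum (remaining st :\ e) picks_left.-1.

Definition admissible (e : 'I_p) : bool :=
  (e \in remaining st) && (c e 0 * wmin <= budget_rem st - reserve e).

Definition trial_weight (e : 'I_p) : R :=
  Num.min (Num.max wmin (Num.min wmax (budget_share / c e 0)))
          ((budget_rem st - reserve e) / c e 0).

Definition gain (e : 'I_p) : R :=
  let Minv := invmx (grounded_matrix st) in
  let a := incidence G e in
  let r := (a^T *m Minv *m a) 0 0 in
  let b2 := \sum_i (Minv *m a) i 0 ^+ 2 in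
  n%:R * trial_weight e * b2 / (1 + trial_weight e * r).

(* Largest gain, ties going to the smallest index. *)
Definition best_candidate (e : 'I_p) : bool :=
  admissible e &&
  [forall f, admissible f ==>
     (gain f < gain e) || ((gain f == gain e) && (e <= f)%N)].

Definition commit (e : 'I_p) : state :=
  State (grounded_matrix st
           + trial_weight e *: (incidence G e *m (incidence G e)^T))
        (e |: used st) (remaining st :\ e)
        (budget_rem st - c e 0 * trial_weight e)
        (\col_f if f == e then trial_weight e else committed st f 0).

(* None when no candidate is admissible. *)
Definition greedy_step : option state :=
  omap commit [pick e | best_candidate e].

End Iteration.

Definition greedy_state (l : nat) : option state :=
  iter l (obind greedy_step) (Some init_state).

(* Selected edges with their weights, or None when no design is reported. *)
Definition reserve_capped_greedy : option ({set 'I_p} * 'cV[R]_p) :=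
  if (p < k)%N || (C < wmin * smallest_costs_sum setT k) then None
  else omap (fun st => (used st, committed st)) (greedy_state k).

End Design.

Definition design_point (R : realFieldType) (p : nat)
    (out : {set 'I_p} * 'cV[R]_p) : 'cV[R]_p * 'cV[bool]_p :=
  (\col_e (if e \in out.1 then out.2 e 0 else 0), \col_e (e \in out.1)).

(* Main.v *)
(* The sum of the m smallest costs in A is the minimum of the cost sums of the
   m-subsets of A.  Hence, if B realizes the r smallest costs of the remaining
   edges and e is in B, the reserve of e is at most wmin times the cost of
   B :\ e: every e in B is admissible as soon as the remaining budget pays for
   B at weight wmin.  The cap on the trial weight leaves at least the reserve of
   the selected edge, so this budget invariant survives each iteration. *)
Require Import Defs.
From mathcomp Require Import all_boot all_order all_algebra.

Import Order.TTheory GRing.Theory Num.Theory.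
Local Open Scope ring_scope.

Set Implicit Arguments.
Unset Strict Implicit.
Unset Printing Implicit Defensive.

(** Induction on [s]: its head [x] is at most the head [y] of the subsequence, and whether [y] is
    [x] itself or occurs later, the tail of [t] is a subsequence of the tail of [s]. *)
Lemma sum_take_sorted_le_subseq (R : numDomainType) (s t : seq R) :
  sorted <=%R s -> subseq t s ->
  \sum_(x <- take (size t) s) x <= \sum_(x <- t) x.
Proof.
elim: s t => [|x s IHs] [|y t] //=; rewrite ?big_nil // => s_sorted sub_ts.
have /andP[x_le_s s_sorted'] : all (>= x) s && sorted <=%R s.
  by rewrite -path_sortedE //; apply: le_trans.
have x_le_y : x <= y.
  by case: eqP sub_ts => [->//|_ /mem_subseq/(_ y (mem_head _ _))/(allP x_le_s)].
have sub_ts' : subseq t s.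
  by case: ifP sub_ts => // _; apply: subseq_trans; exact: subseq_cons.
by rewrite !big_cons lerD // IHs.
Qed.

Section SmallestCosts.
Variables (R : realFieldType) (p : nat) (c : 'cV[R]_p).
Implicit Types (A B : {set 'I_p}) (m : nat).

Lemma smallest_costs_sum_take A m : (m <= #|A|)%N ->
  smallest_costs_sum c A m =
  \sum_(x <- take m (sort <=%R [seq c e 0 | e in A])) x.
Proof.
move=> m_le; rewrite /smallest_costs_sum.
set s := sort _ _.
have size_s : size s = #|A| by rewrite size_sort size_map cardE.
rewrite [RHS](big_nth 0) size_takel ?size_s //.
by apply: eq_big_nat => i /andP[_ i_lt]; rewrite nth_take.
Qed.

Lemma smallest_costs_sum_le A B : B \subset A ->
  smallest_costs_sum c A #|B| <= \sum_(e in B) c e 0.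
Proof.
move=> sBA; rewrite smallest_costs_sum_take ?subset_leq_card //.
set s := sort _ _; pose t := sort <=%R [seq c e 0 | e in B].
have size_t : size t = #|B| by rewrite size_sort size_map cardE.
have -> : \sum_(e in B) c e 0 = \sum_(x <- t) x.
  rewrite -big_enum -(big_map (fun e => c e 0) predT id).
  by apply: perm_big; rewrite perm_sym perm_sort.
rewrite -size_t; apply: sum_take_sorted_le_subseq.
  exact: sort_le_sorted.
apply: subseq_sort; [exact: le_total | exact: le_trans |].
apply: map_subseq.
(* Both enumerations follow the order of ['I_p], so that of [B] filters that of [A]; sorting then
   preserves the subsequence relation between the cost lists. *)
have -> : enum B = [seq e <- enum A | e \in B].
  rewrite /enum_mem -filter_predI; apply: eq_filter => e /=.
  by case eB: (e \in B) => //=; rewrite (subsetP sBA).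
exact: filter_subseq.
Qed.

Lemma smallest_costs_sum_attained A m : (m <= #|A|)%N ->
  exists B, [/\ B \subset A, #|B| = m
              & smallest_costs_sum c A m = \sum_(e in B) c e 0].
Proof.
(* Sorting the edges by cost, rather than the costs, lets the first [m] of them serve as [B]. *)
move=> m_le; rewrite smallest_costs_sum_take // sort_map -map_take.
set t := sort _ _.
have t_uniq : uniq (take m t) by rewrite take_uniq // sort_uniq enum_uniq.
exists [set e in take m t]; split.
- by apply/subsetP => e; rewrite inE => /mem_take; rewrite mem_sort mem_enum.
- by rewrite cardsE (card_uniqP t_uniq) size_takel // size_sort -cardE.
- rewrite big_map big_uniq //=.
  by apply: eq_bigl => e; rewrite inE.
Qed.

(** The support of [z] has [k] edges, each of weight at least [wmin], so it already costs at least
    [wmin] times the [k] smallest costs. *)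
Lemma P0_constraints_budget (wmin wmax C : R) k w z :
  (forall e, 0 < c e 0) -> 0 <= wmin -> P0_constraints c wmin wmax C k w z ->
  (k <= p)%N /\ wmin * smallest_costs_sum c setT k <= C.
Proof.
move=> c_gt0 wmin_ge0 [w_ge0 cw_le wz z_card].
pose B := [set e | z e 0].
have card_B : #|B| = k.
  by rewrite -z_card -sum1dep_card big_mkcond; apply: eq_bigr => e _; case: (z e 0).
split; first by rewrite -card_B -[X in (_ <= X)%N]card_ord max_card.
apply: le_trans cw_le; rewrite mxE.
have := smallest_costs_sum_le (subsetT B); rewrite card_B.
move=> /(ler_wpM2l wmin_ge0)/le_trans; apply.
(* The edges outside [B] contribute a nonnegative cost. *)
rewrite mulr_sumr [leRHS](bigID (mem B)) /= -[leLHS]addr0 lerD //.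
  apply: ler_sum => e; rewrite inE => ze; rewrite !mxE mulrC ler_pM2l //.
  by have := wz e; rewrite ze mul1r => /andP[].
by apply: sumr_ge0 => e _; rewrite mxE mulr_ge0 // ltW.
Qed.

End SmallestCosts.

Section Greedy.
Variables (R : realFieldType) (n p : nat) (G : network R n p).
Variables (c : 'cV[R]_p) (wmin wmax C : R) (k : nat).
Hypotheses (c_gt0 : forall e, 0 < c e 0) (wmin_le_wmax : wmin <= wmax).
Hypothesis wmin_ge0 : 0 <= wmin.
Implicit Types (st : state R n p) (l : nat).

(** Describes the state after [l] iterations. [budget_covers] keeps some candidate admissible;
    [committed_bounds] and [budget_balance] yield the weight and cost constraints at [l = k]. *)
Record greedy_invariant (l : nat) (st : state R n p) : Prop := GreedyInvariant {
  card_used : #|used st| = l;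
  remainingE : remaining st = ~: used st;
  budget_covers :
    wmin * smallest_costs_sum c (remaining st) (k - l) <= budget_rem st;
  committed_bounds :
    forall e, e \in used st -> wmin <= committed st e 0 <= wmax;
  budget_balance :
    \sum_(e in used st) c e 0 * committed st e 0 + budget_rem st = C
}.

(** Admissibility says exactly that the outer cap is at least [wmin]; the clamped share lies between
    [wmin] and [wmax] by construction. *)
Lemma trial_weight_bounds st e : admissible c wmin k st e ->
  wmin <= trial_weight c wmin wmax k st e <= wmax.
Proof.
case/andP=> _ adm; rewrite /trial_weight le_min le_max lexx /=.
rewrite ler_pdivlMr // mulrC adm /=.
by rewrite ge_min ge_max wmin_le_wmax ge_min lexx.
Qed.

Lemma trial_weight_reserve st e :
  reserve c wmin k st e <=
  budget_rem st - c e 0 * trial_weight c wmin wmax k st e.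
Proof.
rewrite lerBrDr -lerBrDl mulrC -ler_pdivlMr //.
by rewrite /trial_weight ge_min lexx orbT.
Qed.

Lemma exists_admissible l st : (l < k <= p)%N -> greedy_invariant l st ->
  exists e, admissible c wmin k st e.
Proof.
move=> /andP[l_lt k_le] [cardU remE cover _ _].
have card_rem : #|remaining st| = (p - l)%N.
  by rewrite remE cardsCs setCK card_ord cardU.
have [|B [sB cardB sumB]] :=
    @smallest_costs_sum_attained _ _ c (remaining st) (k - l).
  by rewrite card_rem leq_sub2r.
have /card_gt0P[e eB] : (0 < #|B|)%N by rewrite cardB subn_gt0.
exists e; rewrite /admissible (subsetP sB) //=.
rewrite lerBrDr; apply: le_trans cover.
rewrite /reserve mulrC -mulrDr ler_wpM2l // sumB (big_setD1 e) //= lerD2l.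
(* Both sides equal [k - l - 1], the number of picks that follow [e]. *)
have -> : (picks_left k st).-1 = #|B :\ e|.
  by rewrite /picks_left cardU -cardB (cardsD1 e B) eB.
exact: smallest_costs_sum_le (setSD _ sB).
Qed.

(** Two successive choices: first maximize the gain, then minimize the index among the admissible
    candidates that reach this maximum. *)
Lemma exists_best_candidate st : (exists e, admissible c wmin k st e) ->
  exists e, best_candidate G c wmin wmax k st e.
Proof.
case=> e0 adm0; pose g := gain G c wmin wmax k st.
case: (arg_maxP g adm0) => e1 adm1 max1.
pose top := [pred e | admissible c wmin k st e & g e == g e1].
have top1 : top e1 by rewrite /= adm1 eqxx.
case: (arg_minnP (fun e : 'I_p => e : nat) top1) => e /andP[adm /eqP ge] min_e.
exists e; rewrite /best_candidate adm; apply/forallP => f; apply/implyP => admf.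
rewrite -!/(g _) ge; move: (max1 f admf) => /=; case: ltgtP => //= gf _.
by rewrite min_e //= admf gf eqxx.
Qed.

Lemma commit_invariant l st e : (l < k)%N -> greedy_invariant l st ->
  admissible c wmin k st e ->
  greedy_invariant l.+1 (commit G c wmin wmax k st e).
Proof.
move=> l_lt [cardU remE cover bnd bal] adm.
have eU : e \notin used st by case/andP: adm; rewrite remE inE.
split=> /=.
- by rewrite cardsU1 eU cardU.
- by rewrite remE setCU setIC setDE.
(* The reserve of [e] is the very amount that must be covered after the pick, since [picks_left]
   minus one is [k - l.+1]. *)
- apply: le_trans (trial_weight_reserve st e).
  by rewrite /reserve /picks_left cardU subnS.
- move=> f; rewrite in_setU1 mxE; case: eqP => [-> _|_ /bnd //].
  exact: trial_weight_bounds.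
(* The cost of [e] cancels against the drop of the remaining budget; earlier weights are unchanged
   because [e] was not in [used st]. *)
- rewrite big_setU1 //= mxE eqxx addrAC addrCA subrr addr0 addrC -bal.
  congr (_ + _); apply: eq_bigr => f fU; rewrite mxE.
  by case: eqP fU eU => // -> ->.
Qed.

Lemma greedy_step_invariant l st : (l < k <= p)%N -> greedy_invariant l st ->
  exists2 st', greedy_step G c wmin wmax k st = Some st'
             & greedy_invariant l.+1 st'.
Proof.
move=> lkp inv; rewrite /greedy_step; case: pickP => [e best|none].
  exists (commit G c wmin wmax k st e) => //.
  by apply: commit_invariant inv _; [case/andP: lkp | case/andP: best].
have [e] := exists_best_candidate (exists_admissible lkp inv).
by rewrite none.
Qed.

Lemma greedy_state_invariant l :
  (k <= p)%N -> wmin * smallest_costs_sum c setT k <= C -> (l <= k)%N ->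
  exists2 st, greedy_state G c wmin wmax C k l = Some st
            & greedy_invariant l st.
Proof.
move=> k_le C_ge; elim: l => [_|l IHl l_lt].
  exists (init_state G C) => //; split=> /=.
  - by rewrite cards0.
  - by rewrite setC0.
  - by rewrite subn0.
  - by move=> e; rewrite inE.
  - by rewrite big_set0 add0r.
have [st st_l inv] := IHl (ltnW l_lt).
rewrite /greedy_state iterS -/(greedy_state G c wmin wmax C k l) st_l /=.
by apply: greedy_step_invariant inv; rewrite l_lt.
Qed.

Lemma greedy_invariant_feasible st : greedy_invariant k st ->
  feasible_point (P0 G c wmin wmax C k) (design_point (used st, committed st)).
Proof.
move=> [cardU _ cover bnd bal]; rewrite /design_point /=.
split=> [e||e|]; rewrite ?mxE /=.
- case: ifP => // /bnd /andP[wmin_le _]; exact: le_trans wmin_le.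
(* At [l = k] the covered sum is empty, so [budget_covers] reduces to nonnegativity of what is left,
   and the balance bounds the total cost by [C]. *)
- have budget_ge0 : 0 <= budget_rem st.
    by move: cover; rewrite subnn /smallest_costs_sum big_geq // mulr0.
  rewrite -bal -[leLHS]addr0 lerD // (eq_bigr (fun e =>
    if e \in used st then c e 0 * committed st e 0 else 0)).
    by rewrite -big_mkcond.
  by move=> e _; rewrite !mxE; case: ifP => // _; rewrite mulr0.
- by case: ifP => [/bnd|]; rewrite ?mul1r // !mul0r lexx.
- rewrite -cardU -sum1_card [RHS]big_mkcond /=.
  by apply: eq_bigr => e _; rewrite mxE; case: (e \in _).
Qed.

End Greedy.

Theorem proposition4 (R : realFieldType) (n p : nat) (G : network R n p)
    (c : 'cV[R]_p) (wmin wmax C : R) (k : nat)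
    (C_gt0 : 0 < C) (k_ge1 : (1 <= k)%N)
    (c_gt0 : forall e, 0 < c e 0)
    (wmin_gt0 : 0 < wmin) (wmin_le_wmax : wmin <= wmax) :
  (feasible (P0 G c wmin wmax C k) <->
     (k <= p)%N /\ wmin * smallest_costs_sum c setT k <= C) /\
  ((k <= p)%N /\ wmin * smallest_costs_sum c setT k <= C ->
     (forall l : nat, (1 <= l <= k)%N ->
        exists2 st, greedy_state G c wmin wmax C k l.-1 = Some st
                  & exists e, admissible c wmin k st e) /\
     (exists out : {set 'I_p} * 'cV[R]_p,
        [/\ reserve_capped_greedy G c wmin wmax C k = Some out,
            feasible_point (P0 G c wmin wmax C k) (design_point out)
          & #|out.1| = k])).
Proof.
have wmin_ge0 := ltW wmin_gt0.
(* Proved first because the greedy output is also the witness for feasibility of [P0]. *)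
have greedy_correct : (k <= p)%N /\ wmin * smallest_costs_sum c setT k <= C ->
    exists out : {set 'I_p} * 'cV[R]_p,
      [/\ reserve_capped_greedy G c wmin wmax C k = Some out,
          feasible_point (P0 G c wmin wmax C k) (design_point out)
        & #|out.1| = k].
  move=> [k_le C_ge].
  have [st st_k inv] := greedy_state_invariant G c_gt0 wmin_le_wmax wmin_ge0
    k_le C_ge (leqnn k).
  exists (used st, committed st); split.
  - by rewrite /reserve_capped_greedy ltnNge k_le ltNge C_ge /= st_k.
  - exact: greedy_invariant_feasible inv.
  - exact: card_used inv.
split; [split=> [[[w z]]|cond] | move=> cond; split=> [l|]].
- exact: P0_constraints_budget.
- by have [out [_ feas _]] := greedy_correct cond; exists (design_point out).
(* Iteration [l.+1] starts from the state reached after [l] steps, where the invariant holds. *)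
- case: cond => k_le C_ge; case: l => // l /= l_lt.
  have [st st_l inv] := greedy_state_invariant G c_gt0 wmin_le_wmax wmin_ge0
    k_le C_ge (ltnW l_lt).
  by exists st => //; apply: exists_admissible inv; rewrite ?l_lt.
- exact: greedy_correct.
Qed.
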